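(* The problem of computing the prickliness $\pi(T)$ of a 1.5D terrain $T$ with $n$ vertices has an $\Omega(n\log n)$ lower bound in the bounded-degree algebraic decision tree model.
   Context: A 1.5D terrain $T$ is an $x$-monotone polygonal line in $\mathbb{R}^2$, given by its sequence of vertices; two vertices are neighbors if they are joined by an edge. A vertex is internal if it is not an endpoint of the polygonal line. A vertex $v$ is convex if there is a non-vertical line through $v$ that leaves all neighboring points of $v$ on $T$ below it. For a vector $\vec w\in\mathbb{R}^2$, a vertex $v$ is a local maximum of $T$ in direction $\vec w$ if $\langle v,\vec w\rangle > \langle u,\vec w\rangle$ for every neighbor $u$ of $v$. Let $\pi_{\vec w}(T)$ be the number of internal and convex vertices of $T$ that are local maxima of $T$ in direction $\vec w$. The prickliness of $T$ is $\pi(T)=\max_{\vec w}\pi_{\vec w}(T)$ (equivalently, the maximum over all invertible affine transformations $A$ of the plane of the number of internal and convex vertices of $T$ that are local maxima, in the vertical direction, of $A(T)$). In the bounded-degree algebraic decision tree model, an algorithm is a decision tree whose internal nodes branch on the sign of a polynomial of degree bounded by a fixed constant in the input numbers; the cost is the depth of the tree. It is known that deciding whether $n$ given integers are pairwise distinct requires $\Omega(n\log n)$ cost in this model. *)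

(* Defs.v *)
From HB Require Import structures.
From mathcomp Require Import all_boot all_order all_algebra.
From mathcomp Require Import boolp classical_sets reals topology normedtype exp.
From mathcomp Require mpoly.
(* The notations of mpoly cannot be loaded together with those of
   MathComp-Analysis; [mpoly n R] is the type of polynomials over R in n
   variables. *)
Import -(notations) mpoly.

Set Implicit Arguments.
Unset Strict Implicit.
Unset Printing Implicit Defensive.

Import Order.TTheory GRing.Theory Num.Theory.
Import numFieldNormedType.Exports.
Local Open Scope ring_scope.

Section Terrain.
Variables (R : realType) (n : nat).

(* The vertices are listed from left to right. *)
Record terrain := Terrain {
  vertex :> 'I_n -> R * R;
  vertex_mono : forall i j : 'I_n, (i < j)%N -> (vertex i).1 < (vertex j).1 }.

Definition neighbors (i j : 'I_n) : bool :=
  (j == i.+1 :> nat) || (i == j.+1 :> nat).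

Definition internal (i : 'I_n) : bool := (0 < i < n.-1)%N.

Definition on_terrain (T : terrain) (p : R * R) : Prop :=
  exists i j, neighbors i j /\ exists2 t : R, 0 <= t <= 1 &
    p = ((1 - t) * (T i).1 + t * (T j).1, (1 - t) * (T i).2 + t * (T j).2).

(* The line has slope m; the "neighboring points" of a vertex v are the points
   of the polygonal line, other than v, in a neighborhood of v. *)
Definition convex (T : terrain) (i : 'I_n) : Prop :=
  exists m : R, \forall p \near nbhs (T i), on_terrain T p -> p <> T i ->
    p.2 < (T i).2 + m * (p.1 - (T i).1).

Definition dot (u w : R * R) : R := u.1 * w.1 + u.2 * w.2.

Definition local_max (T : terrain) (w : R * R) (i : 'I_n) : bool :=
  [forall j, neighbors i j ==> (dot (T j) w < dot (T i) w)].

Definition prickliness_dir (T : terrain) (w : R * R) : nat :=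
  #|[set i | [&& internal i, `[< convex T i >] & local_max T w i]]|.

(* Maximum of [prickliness_dir T w] over all w; its values are at most n. *)
Definition prickliness (T : terrain) : nat :=
  \max_(k < n.+1 | `[< exists w, prickliness_dir T w = k >]) k.

Lemma prickliness_dir_le (T : terrain) w :
  (prickliness_dir T w <= prickliness T)%N.
Proof.
have lt_n : (prickliness_dir T w < n.+1)%N.
  by rewrite ltnS -[leqRHS]card_ord max_card.
by apply: (leq_bigmax_cond (Ordinal lt_n)); apply/asboolP; exists w.
Qed.

Lemma prickliness_attained (T : terrain) :
  exists w, prickliness_dir T w = prickliness T.
Proof.
have lt_n : (prickliness_dir T (0, 0)%R < n.+1)%N.
  by rewrite ltnS -[leqRHS]card_ord max_card.
pose P := [pred k : 'I_n.+1 | `[< exists w, prickliness_dir T w = k >]].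
have P_gt0 : (0 < #|P|)%N.
  by apply/card_gt0P; exists (Ordinal lt_n); apply/asboolP; exists (0, 0)%R.
have [k /asboolP[w Ew] Ek] := eq_bigmax_cond (fun k : 'I_n.+1 => k : nat) P_gt0.
by exists w; rewrite Ew; exact: esym Ek.
Qed.

(* The x-coordinates of the n vertices, followed by their y-coordinates. *)
Definition coords (T : terrain) (k : 'I_(n + n)) : R :=
  match split k with inl i => (T i).1 | inr i => (T i).2 end.

End Terrain.

Section DecisionTree.
Variables (R : realType) (N : nat) (A : Type).

(* Algebraic decision trees on N real inputs, with outputs in A; the three
   subtrees of a node are taken when its polynomial is negative, zero and
   positive, respectively. *)
Inductive adt : Type :=
| Leaf of A
| Node of mpoly N R & adt & adt & adt.

Fixpoint run (t : adt) (x : 'I_N -> R) : A :=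
  match t with
  | Leaf a => a
  | Node p tneg tzero tpos =>
      if meval x p < 0 then run tneg x
      else if meval x p == 0 then run tzero x
      else run tpos x
  end.

Fixpoint depth (t : adt) : nat :=
  match t with
  | Leaf _ => 0
  | Node _ t1 t2 t3 => (maxn (depth t1) (maxn (depth t2) (depth t3))).+1
  end.

(* [msize p] is the total degree of p plus one, and 0 for p = 0. *)
Fixpoint degree_le (d : nat) (t : adt) : Prop :=
  match t with
  | Leaf _ => True
  | Node p t1 t2 t3 =>
      [/\ (msize p <= d.+1)%N, degree_le d t1, degree_le d t2 & degree_le d t3]
  end.

End DecisionTree.

Definition computes_prickliness (R : realType) (n : nat)
    (t : adt R (n + n) nat) : Prop :=
  forall T : terrain R n, run t (coords T) = prickliness T.

(* Main.v *)
Require Import Defs.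
From mathcomp Require Import boolp topology normedtype sequences.
From mathcomp Require Import all_boot all_order all_algebra perm.
From mathcomp Require Import reals exp zify ring lra.
From mathcomp Require mpoly.
Import -(notations) mpoly.
Import Order.TTheory GRing.Theory Num.Theory.
Import numFieldNormedType.Exports.
Local Open Scope ring_scope.

Set Implicit Arguments.
Unset Strict Implicit.
Unset Printing Implicit Defensive.

(* In direction (-m, 1) an internal vertex is a convex local maximum iff m lies
   strictly between the slope of its right edge and that of its left edge.
   With unit horizontal steps and slopes 2 z_i, z_i, 2, 0 (i < k, 0 < z_i <= 1)
   the prickliness is k plus the maximal depth of the intervals (z_i, 2 z_i):
   k + 1 if they are disjoint, and at least k + 2 if two of the z_i coincide.

   No bound on connected components (Milnor-Thom) is needed, because the hard
   inputs are z_i = x ^ w_i with x small, where w_i = (d + 1) ^ (s i) for a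
   permutation s.  The sign of a polynomial of degree <= d is then that of the
   coefficient of its monomial of least w-weight.  If s and s' follow the same
   path and the products of these monomials along the path agree, then each
   single monomial agrees, since each minimizes the weight; so every positive
   combination of the two weights follows the same path too.  One such
   combination has w_i = w_j for some i <> j, which changes the prickliness.
   Hence k! is at most the number of paths, 3 ^ h, times the number of monomials
   of degree <= d h in k variables, which is at most 2 ^ (k + d h). *)

(** * Initial monomials with respect to a weight *)

Section Weights.
Variables (R : realType) (k : nat).
Implicit Types (w u : 'I_k -> nat) (q : mpoly k R) (m : multinom k).

Definition weight w (f : 'I_k -> nat) : nat := (\sum_i f i * w i)%N.

Definition init_mnm w q : multinom k :=
  head (@mnm0 k) (sort (fun m m' => (weight w m <= weight w m')%N) (msupp q)).

Definition is_init w q m : Prop :=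
  m \in msupp q /\
  forall m', m' \in msupp q -> m' != m -> (weight w m < weight w m')%N.

(** Genericity makes the monomial of least weight unique in every nonzero polynomial of degree at
    most [d], so no terms of least weight can cancel. *)
Definition generic (d : nat) w : Prop :=
  forall m m', (mdeg m <= d)%N -> (mdeg m' <= d)%N ->
    weight w m = weight w m' -> m = m'.

Lemma init_mnm0 w : init_mnm w 0 = @mnm0 k.
Proof. by rewrite /init_mnm msupp0. Qed.

Lemma init_mnm_supp w q : q != 0 -> init_mnm w q \in msupp q.
Proof.
rewrite -msupp_eq0 /init_mnm => q_neq0.
set r := (fun _ _ => _); rewrite -(mem_sort r) -nth0 mem_nth // size_sort.
by case: (msupp q) q_neq0.
Qed.

Lemma init_mnm_le w q m :
  m \in msupp q -> (weight w (init_mnm w q) <= weight w m)%N.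
Proof.
rewrite /init_mnm; set r := (fun _ _ => _).
have r_total : total r by move=> x y; apply: leq_total.
have r_trans : transitive r by move=> x y z; apply: leq_trans.
rewrite -(mem_sort r); have := sort_sorted r_total (msupp q).
case: (sort r (msupp q)) => [|m0 s] //= /(order_path_min r_trans)/allP min_m0.
by rewrite inE => /predU1P[-> // | /min_m0].
Qed.

Lemma mdeg_init_mnm w q d :
  (msize q <= d.+1)%N -> (mdeg (init_mnm w q) <= d)%N.
Proof.
have [->|q_neq0] := eqVneq q 0; first by rewrite init_mnm0 mdeg0.
move=> /(leq_trans (msize_mdeg_lt (init_mnm_supp w q_neq0))).
by rewrite ltnS.
Qed.

Lemma init_mnm_is_init w q d : generic d w -> (msize q <= d.+1)%N -> q != 0 ->
  is_init w q (init_mnm w q).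
Proof.
move=> gen_w le_q q_neq0; split=> [|m' m'q]; first exact: init_mnm_supp.
apply: contra_neqT; rewrite -leqNgt => le_m'.
apply: gen_w; last by apply/eqP; rewrite eqn_leq le_m' init_mnm_le.
- exact: leq_trans (msize_mdeg_lt m'q) le_q.
- exact: mdeg_init_mnm.
Qed.

(** The weight of a monomial is linear in the weight vector. Strictness comes from the [w] part,
    since [a] is positive while [b] may vanish. *)
Lemma is_init_comb w w' u (a b : nat) q m : (0 < a)%N ->
  (forall i, u i = a * w i + b * w' i)%N ->
  is_init w q m -> is_init w' q m -> is_init u q m.
Proof.
move=> a_gt0 def_u [mq min_w] [_ min_w']; split=> // m' m'q neq_m'.
have weight_u f : weight u f = (a * weight w f + b * weight w' f)%N.
  rewrite /weight !big_distrr -big_split /=; apply: eq_bigr => i _.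
  by rewrite def_u mulnDr !(mulnCA (f i)).
rewrite !weight_u -addSn leq_add // ?leq_mul2l ?ltn_mul2l ?a_gt0 ?min_w //.
by rewrite (ltnW (min_w' _ m'q neq_m')) orbT.
Qed.

Lemma meval_weight w q (x : R) :
  meval (fun i => x ^+ w i) q = \sum_(m <- msupp q) mcoeff m q * x ^+ weight w m.
Proof.
rewrite mevalE; apply: eq_bigr => m _; congr (_ * _).
rewrite /weight -prodrXr; apply: eq_bigr => i _.
by rewrite -exprM mulnC.
Qed.

(** On the curve [x ^+ w i] the polynomial becomes univariate in [x], and its term of lowest
    exponent dominates as [x] tends to 0 from above. *)
Lemma is_init_sign w q m : is_init w q m ->
  exists2 e : R, 0 < e & forall x, 0 < x < e ->
    Num.sg (meval (fun i => x ^+ w i) q) = Num.sg (mcoeff m q).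
Proof.
move=> [mq min_m]; set c := mcoeff m q.
have c_neq0 : c != 0 by rewrite -mcoeff_msupp.
pose C : R := \sum_(m' <- msupp q) `|mcoeff m' q|.
have C_ge0 : 0 <= C by apply: sumr_ge0.
have C1_gt0 : 0 < C + 1 by rewrite ltr_wpDl.
(* For [x] below 1 the other terms sum to at most [C * x ^+ (weight w m).+1]; the second bound makes
   this smaller than the leading term. *)
exists (Num.min 1 (`|c| / (C + 1))).
  by rewrite lt_min ltr01 divr_gt0 // normr_gt0.
move=> x /andP[x_gt0]; rewrite lt_min ltr_pdivlMr // => /andP[x_lt1 x_lt].
rewrite meval_weight (bigD1_seq m) ?msupp_uniq //= -/c.
set S : R := \sum_(i <- _ | _) _.
have S_lt : `|S| < `|c| * x ^+ weight w m.
  have le_S : `|S| <= C * x ^+ (weight w m).+1.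
    apply: le_trans (ler_norm_sum _ _ _) _.
    rewrite mulr_suml big_mkcond big_seq [leRHS]big_seq /=.
    apply: ler_sum => m' m'q; case: ifP => [neq_m'|_].
      rewrite normrM ler_wpM2l ?normr_ge0 //.
      rewrite ger0_norm ?exprn_ge0 ?(ltW x_gt0) //.
      by rewrite ler_iXn2l ?min_m.
    by rewrite mulr_ge0 ?normr_ge0 // exprn_ge0 ?ltW.
  apply: le_lt_trans le_S _.
  rewrite exprS mulrA ltr_pM2r ?exprn_gt0 //; apply: le_lt_trans x_lt.
  by rewrite mulrC ler_pM2l // lerDl.
move: S_lt; have xw_gt0 : 0 < x ^+ weight w m by rewrite exprn_gt0.
(* As the power of [x] is positive, it remains to see that adding [S] to some [y] of larger absolute
   value keeps the sign of [y]. *)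
rewrite -[x ^+ _ in X in X -> _]gtr0_norm // -normrM.
rewrite -[RHS]mulr1 -(gtr0_sg xw_gt0) -sgrM.
set y := c * _ => S_lt; clearbody S y.
have [y_gt0|y_lt0|y_eq0] := ltrgt0P y.
- rewrite !gtr0_sg //; move: S_lt; rewrite (gtr0_norm y_gt0) ltr_norml.
  by rewrite -subr_gt0 opprK addrC => /andP[].
- rewrite !ltr0_sg //; move: S_lt; rewrite (ltr0_norm y_lt0) ltr_norml.
  by rewrite -[S < - y]subr_lt0 opprK addrC => /andP[].
- by move: S_lt; rewrite y_eq0 normr0 ltNge normr_ge0.
Qed.

End Weights.

(** * Paths of a decision tree determined by initial monomials *)

Definition branch (R : realType) (A : Type) (c : R) (xneg xzero xpos : A) : A :=
  if c < 0 then xneg else if c == 0 then xzero else xpos.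

Lemma branch_sg (R : realType) (A : Type) (c c' : R) (x y z : A) :
  Num.sg c = Num.sg c' -> branch c x y z = branch c' x y z.
Proof.
by move=> eq_sg; rewrite /branch -(sgr_lt0 c) -(sgr_eq0 c) eq_sg sgr_lt0 sgr_eq0.
Qed.

Section Tropical.
Variables (R : realType) (k : nat) (A : Type).
Implicit Types (w u : 'I_k -> nat) (t : adt R k A).

(* For p = 0, [init_mnm] is the junk value 1, whose coefficient 0 selects the
   zero branch, as [run] does. *)
Fixpoint code w t : nat :=
  match t with
  | Leaf _ => 0
  | Node p t1 t2 t3 =>
      branch (mcoeff (init_mnm w p) p)
        (3 * code w t1) (3 * code w t2 + 1) (3 * code w t3 + 2)
  end%N.

Fixpoint init_sum w t : 'I_k -> nat :=
  match t with
  | Leaf _ => fun=> 0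
  | Node p t1 t2 t3 => fun i =>
      init_mnm w p i + branch (mcoeff (init_mnm w p) p)
        (init_sum w t1 i) (init_sum w t2 i) (init_sum w t3 i)
  end%N.

(** Each level of the tree contributes one base 3 digit. *)
Lemma code_lt w t : (code w t < 3 ^ depth t)%N.
Proof.
elim: t => [//|p t1 IH1 t2 IH2 t3 IH3] /=.
have bound t' : (code w t' < 3 ^ depth t')%N ->
    (depth t' <= maxn (depth t1) (maxn (depth t2) (depth t3)))%N ->
    (3 * code w t' + 2 < 3 ^ (maxn (depth t1) (maxn (depth t2) (depth t3))).+1)%N.
  move=> lt_t' le_t'; rewrite expnS.
  apply: (@leq_trans (3 * (code w t').+1)); first by rewrite mulnS addnC.
  by rewrite leq_mul2l /= (leq_trans lt_t') // leq_exp2l.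
rewrite /branch; case: ifP => _; [|case: ifP => _].
- apply: leq_ltn_trans (bound _ IH1 _); first exact: leq_addr.
  exact: leq_maxl.
- apply: leq_ltn_trans (bound _ IH2 _); first by rewrite leq_add2l.
  by rewrite !leq_max leqnn orbT.
- by apply: (bound _ IH3); rewrite !leq_max leqnn !orbT.
Qed.

Lemma init_sum_le w t d :
  degree_le d t -> (\sum_i init_sum w t i <= d * depth t)%N.
Proof.
elim: t => [a|p t1 IH1 t2 IH2 t3 IH3] /=.
  by rewrite big1.
case=> le_p /IH1{}IH1 /IH2{}IH2 /IH3{}IH3.
rewrite big_split /= mulnS leq_add //.
  by rewrite -mdegE; apply: mdeg_init_mnm.
have le_d t' : (depth t' <= maxn (depth t1) (maxn (depth t2) (depth t3)))%N ->
    (\sum_i init_sum w t' i <= d * depth t')%N ->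
  (\sum_i init_sum w t' i <= d * maxn (depth t1) (maxn (depth t2) (depth t3)))%N.
  by move=> le_t' /leq_trans; apply; rewrite leq_mul2l le_t' orbT.
rewrite /branch; case: (_ < 0); [|case: (_ == 0)]; apply: le_d => //;
  by rewrite !leq_max leqnn ?orbT.
Qed.

(** The branch taken at the root is the last base 3 digit of the code, so equal codes select the
    same subtree [t']. Quantifying over [f] lets this selection serve for codes, monomials and runs
    alike. *)
Lemma code_node w w' p t1 t2 t3 :
  code w (Node p t1 t2 t3) = code w' (Node p t1 t2 t3) ->
  exists t' : adt R k A, [/\
    forall B (f : adt R k A -> B), branch (mcoeff (init_mnm w p) p)
      (f t1) (f t2) (f t3) = f t',
    forall B (f : adt R k A -> B), branch (mcoeff (init_mnm w' p) p)
      (f t1) (f t2) (f t3) = f t',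
    code w t' = code w' t' & t' = t1 \/ t' = t2 \/ t' = t3].
Proof.
have mod3 a b c c' : (c < 3 -> c' < 3 -> 3 * a + c = 3 * b + c' ->
    a = b /\ c = c')%N.
  move=> lt_c lt_c' E; have Ec : c = c'.
    by have := congr1 (modn^~ 3) E; rewrite /= !(mulnC 3) !modnMDl !modn_small.
  by split=> //; move/eqP: E; rewrite Ec eqn_add2r eqn_mul2l => /eqP.
rewrite /= /branch -(addn0 (3 * code w' t1)%N) -(addn0 (3 * code w t1)%N).
by case: ifP => _; [|case: ifP => _]; (case: ifP => _; [|case: ifP => _]);
  move/mod3 => /(_ isT isT)[] // E _;
  [exists t1 | exists t2 | exists t3]; split => //; auto.
Qed.

(* [init_sum w t] is the monomial of least [w]-weight in the product of the
   polynomials tested on the path followed by [w]. *)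
Lemma init_sum_min w w' t : code w t = code w' t ->
  (weight w (init_sum w t) <= weight w (init_sum w' t))%N.
Proof.
elim: t => [a //|p t1 IH1 t2 IH2 t3 IH3] /code_node[t' [Ew Ew' Et' t'E]].
have weightD f g : weight w (fun i => f i + g i)%N = (weight w f + weight w g)%N.
  by rewrite /weight -big_split; apply: eq_bigr => i _; rewrite mulnDl.
rewrite /= !weightD leq_add //.
  have [->|p_neq0] := eqVneq p 0; first by rewrite !init_mnm0.
  exact: init_mnm_le (init_mnm_supp _ p_neq0).
have -> : weight w (fun i => branch (mcoeff (init_mnm w p) p)
    (init_sum w t1 i) (init_sum w t2 i) (init_sum w t3 i)) =
    weight w (init_sum w t').
  by apply: eq_bigr => i _; rewrite (Ew _ (init_sum w ^~ i)).
have -> : weight w (fun i => branch (mcoeff (init_mnm w' p) p)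
    (init_sum w' t1 i) (init_sum w' t2 i) (init_sum w' t3 i)) =
    weight w (init_sum w' t').
  by apply: eq_bigr => i _; rewrite (Ew' _ (init_sum w' ^~ i)).
by case: t'E Et' => [|[]] ->; auto.
Qed.

(** Induction along the common path: at each node with nonzero polynomial, [w] and [w'] share the
    initial monomial, which is then initial for [u] as well. For small [x] its coefficient decides
    the test at both points. *)
Lemma run_comb d w w' u (a b : nat) t :
  generic d w -> generic d w' -> (0 < a)%N ->
  (forall i, u i = a * w i + b * w' i)%N ->
  degree_le d t -> code w t = code w' t -> init_sum w t =1 init_sum w' t ->
  exists2 e : R, 0 < e & forall x, 0 < x < e ->
    run t (fun i => x ^+ w i) = run t (fun i => x ^+ u i).
Proof.
move=> gen_w gen_w' a_gt0 def_u.
elim: t => [c|p t1 IH1 t2 IH2 t3 IH3]; first by move=> *; exists 1.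
case=> le_p le_1 le_2 le_3 E; have [t' [Ew Ew' Et' t'E]] := code_node E.
move=> /= eq_sum.
have {}eq_sum i : (init_mnm w p i + init_sum w t' i =
                   init_mnm w' p i + init_sum w' t' i)%N.
  by have := eq_sum i; rewrite (Ew _ (init_sum w ^~ i)) (Ew' _ (init_sum w' ^~ i)).
(* Both the monomial at this node and the sum over the rest of the path have least [w]-weight. Since
   the totals agree, neither inequality can be strict, and genericity identifies the monomials. *)
have Einit : init_mnm w p = init_mnm w' p.
  have [->|p_neq0] := eqVneq p 0; first by rewrite !init_mnm0.
  apply: gen_w; rewrite ?(mdeg_init_mnm _ le_p) //.
  have : (weight w (init_mnm w p) + weight w (init_sum w t') =
          weight w (init_mnm w' p) + weight w (init_sum w' t'))%N.
    rewrite /weight -!big_split /=; apply: eq_bigr => i _.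
    by rewrite -!mulnDl eq_sum.
  have := init_mnm_le w (init_mnm_supp w' p_neq0).
  have := init_sum_min Et'.
  move=> le1 le2 EE; apply/eqP; rewrite eqn_leq le2 /=.
  by rewrite -(leq_add2r (weight w (init_sum w t'))) EE leq_add2l.
have {}eq_sum : init_sum w t' =1 init_sum w' t'.
  by move=> i; apply/eqP; rewrite -(eqn_add2l (init_mnm w p i)) eq_sum Einit.
have [e0 e0_gt0 run_e0] : exists2 e : R, 0 < e & forall x, 0 < x < e ->
    run t' (fun i => x ^+ w i) = run t' (fun i => x ^+ u i).
  by case: t'E Et' eq_sum => [|[]] ->; auto.
pose c := mcoeff (init_mnm w p) p.
have [e1 e1_gt0 sg_e1] : exists2 e : R, 0 < e & forall x, 0 < x < e ->
    Num.sg (meval (fun i => x ^+ w i) p) = Num.sg c /\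
    Num.sg (meval (fun i => x ^+ u i) p) = Num.sg c.
  have [p0|p_neq0] := eqVneq p 0.
    exists 1 => // x _; suff -> : c = 0 by rewrite p0 !meval0.
    by rewrite /c p0 mcoeff0.
  have init_w := init_mnm_is_init gen_w le_p p_neq0.
  have init_w' := init_mnm_is_init gen_w' le_p p_neq0.
  have [e1 e1_gt0 He1] := is_init_sign init_w.
  rewrite -Einit in init_w'.
  have [e2 e2_gt0 He2] := is_init_sign (is_init_comb a_gt0 def_u init_w init_w').
  exists (Num.min e1 e2); first by rewrite lt_min e1_gt0.
  move=> x; rewrite lt_min => /and3P[x_gt0 x1 x2].
  by rewrite He1 ?He2 // x_gt0.
exists (Num.min e0 e1); first by rewrite lt_min e0_gt0.
move=> x; rewrite lt_min => /and3P[x_gt0 x0 x1].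
have {x0}run_x : run t' (fun i => x ^+ w i) = run t' (fun i => x ^+ u i).
  by rewrite run_e0 ?x_gt0.
have [sg_w sg_u] : Num.sg (meval (fun i => x ^+ w i) p) = Num.sg c /\
    Num.sg (meval (fun i => x ^+ u i) p) = Num.sg c.
  by apply: sg_e1; rewrite x_gt0.
rewrite -!/(branch _ _ _ _) (branch_sg _ _ _ sg_w) (branch_sg _ _ _ sg_u).
by rewrite !(Ew _ (fun t => run t _)).
Qed.

End Tropical.

(** * Weights from permutations, and a pigeonhole argument *)

Section Permutations.
Local Open Scope nat_scope.

Lemma digits_inj B k (f g : 'I_k -> nat) :
    (forall i, f i < B) -> (forall i, g i < B) ->
  \sum_i f i * B ^ i = \sum_i g i * B ^ i -> f =1 g.
Proof.
elim: k f g => [|k IH] f g lt_f lt_g; first by move=> _ [].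
rewrite !big_ord_recl /= !expn0 !muln1.
have shift h : \sum_(i < k) h (lift ord0 i) * B ^ bump 0 i =
    (\sum_(i < k) h (lift ord0 i) * B ^ i) * B.
  by rewrite big_distrl; apply: eq_bigr => i _; rewrite expnSr mulnA.
rewrite !shift => E.
have E0 : f ord0 = g ord0.
  by have := congr1 (modn^~ B) E; rewrite /= !(addnC (_ ord0)) !modnMDl !modn_small.
move/eqP: E; rewrite E0 eqn_add2l eqn_pmul2r; last exact: leq_ltn_trans (lt_f ord0).
move=> /eqP/IH-/(_ (fun=> lt_f _) (fun=> lt_g _)) E i.
by have [j ->|->//] := unliftP ord0 i; rewrite E.
Qed.

Definition perm_weight (d k : nat) (s : 'S_k) (i : 'I_k) : nat := d.+1 ^ s i.

(** The exponents of a monomial of degree at most [d] are digits in base [d.+1], and its weight is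
    the number with these digits in permuted order. *)
Lemma perm_weight_generic d k (s : 'S_k) : generic d (perm_weight d s).
Proof.
move=> m m' le_m le_m' E.
have digit_lt (m0 : multinom k) i : mdeg m0 <= d -> m0 i < d.+1.
  by rewrite ltnS mdegE; apply: leq_trans; rewrite (bigD1 i) //= leq_addr.
have reindexE (m0 : multinom k) : weight (perm_weight d s) m0 =
    \sum_(i < k) m0 (s^-1 i)%g * d.+1 ^ i.
  rewrite (reindex_inj (@perm_inj _ s)) /=.
  by apply: eq_bigr => i _; rewrite permK.
rewrite !reindexE in E; apply/mnmP => i; rewrite -(permK s i).
by apply: (digits_inj _ _ E) => j; apply: digit_lt.
Qed.

(** A permutation is determined by the order it induces, since [s i] counts the [j] with
    [s j < s i]. Without an inversion both orders coincide. *)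
Lemma perm_inversion k (s s' : 'S_k) : s != s' ->
  exists i j, (s i < s j) && (s' j < s' i).
Proof.
move=> neq_s; suff /existsP[i /existsP[j]] :
    [exists i, exists j, (s i < s j) && (s' j < s' i)].
  by exists i, j.
apply: contraNT neq_s => /existsPn no_inv.
have mono i j : s i < s j -> s' i < s' j.
  move=> lt_ij; have := existsPn (no_inv i) j; rewrite lt_ij -leqNgt leq_eqVlt.
  by case/predU1P => // /val_inj/perm_inj E; rewrite E ltnn in lt_ij.
have rank (t : 'S_k) i : t i = #|[set j | t j < t i]| :> nat.
  rewrite -(card_imset _ (@perm_inj _ t)).
  have -> : t @: [set j | t j < t i] = [set j : 'I_k | j < t i].
    apply/setP => j; rewrite inE; apply/imsetP/idP => [[j']|lt_j].
      by rewrite inE => lt_j' ->.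
    by exists (t^-1 j)%g; rewrite ?inE permKV.
  rewrite cardsE -sum1_card -(big_ord_widen k (fun=> 1)) ?sum1_card ?card_ord //.
  exact: ltnW.
apply/eqP/permP => i; apply: val_inj; rewrite /= (rank s) (rank s').
apply: eq_card => j; rewrite !inE; apply/idP/idP => [/mono //|].
apply: contraLR; rewrite -!leqNgt leq_eqVlt.
by case/predU1P => [/val_inj/perm_inj -> //|/mono/ltnW].
Qed.

Lemma perm_weight_balance d k (s s' : 'S_k) : 0 < d -> s != s' ->
  exists i j a b, [/\ i != j, 0 < a &
    a * perm_weight d s i + b * perm_weight d s' i =
    a * perm_weight d s j + b * perm_weight d s' j].
Proof.
move=> d_gt0 /perm_inversion[i [j /andP[lt_s lt_s']]].
have {}lt_s : perm_weight d s i < perm_weight d s j by rewrite ltn_exp2l.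
have {}lt_s' : perm_weight d s' j < perm_weight d s' i by rewrite ltn_exp2l.
(* At an inversion the two weights differ in opposite directions; scaling each by the gap of the
   other makes the differences cancel. *)
exists i, j, (perm_weight d s' i - perm_weight d s' j),
  (perm_weight d s j - perm_weight d s i); split.
- by apply: contraTneq lt_s => ->; rewrite ltnn.
- by rewrite subn_gt0.
move: (perm_weight d s i) (perm_weight d s j) (perm_weight d s' i)
  (perm_weight d s' j) lt_s lt_s' => x y x' y' /ltnW/subnKC <- /ltnW/subnKC <-.
rewrite !addKn; move: (y - x) (x' - y') => p q.
by rewrite !mulnDr (mulnC q p) -addnA (addnC (p * q)).
Qed.

Lemma bin_le_exp2 n m : 'C(n, m) <= 2 ^ n.
Proof.
rewrite -[n in 'C(n, _)]card_ord -card_draws.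
apply: leq_trans (max_card _) _.
by rewrite -cardsT -powersetT card_powerset cardsT card_ord.
Qed.

(** Pair the factor [i + 1] of one factorial with [k - i] of the other: each product is at least
    [k]. This elementary bound stands in for Stirling's formula. *)
Lemma expnn_le_fact_sqr k : k ^ k <= k`! * k`!.
Proof.
rewrite [in X in _ * X]fact_prod [X in X * _]fact_prod.
rewrite [X in _ * X]big_nat_rev -big_split /=.
rewrite -[k in k ^ k]card_ord -prod_nat_const big_add1 big_mkord /=.
apply: leq_prod => i _; rewrite card_ord.
have := ltn_ord i; move: (i : nat) => j /subnKC <-; move: (k - _) => r.
have -> : 1 + (j.+1 + r).+1 - j.+2 = r.+1 by lia.
by rewrite mulnS leq_add2l mulSn leq_addr.
Qed.

(** Pigeonhole on the pair of code and exponent vector. The vectors have sum at most [D], so by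
    stars and bars their number is a binomial coefficient of [k + D]. *)
Lemma path_collision (R : realType) (A : Type) d k (t : adt R k A) :
    degree_le d t -> 3 ^ depth t * 2 ^ (k + d * depth t) < k`! ->
  exists s s' : 'S_k, [/\ s != s',
    code (perm_weight d s) t = code (perm_weight d s') t &
    init_sum (perm_weight d s) t =1 init_sum (perm_weight d s') t].
Proof.
move=> le_d; set h := depth t; set D := d * h => lt_fact.
have le_sum s : \sum_i init_sum (perm_weight d s) t i <= D by apply: init_sum_le.
have lt_D s i : init_sum (perm_weight d s) t i < D.+1.
  by rewrite ltnS (leq_trans _ (le_sum s)) // (bigD1 i) //= leq_addr.
pose F (s : 'S_k) : 'I_(3 ^ h) * k.-tuple 'I_D.+1 :=
  (Ordinal (code_lt (perm_weight d s) t),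
   [tuple Ordinal (lt_D s i) | i < k]).
have : ~~ injectiveb F.
  apply: contraL lt_fact => /injectiveP F_inj; rewrite -leqNgt.
  rewrite -card_Sn -(card_imset _ F_inj).
  pose S := setX [set: 'I_(3 ^ h)] [set u : k.-tuple 'I_D.+1 | \sum_(i <- u) i <= D].
  apply: (@leq_trans #|S|); last first.
    rewrite cardsX cardsT card_ord card_partial_ord_partitions leq_mul2l.
    by rewrite bin_le_exp2 orbT.
  apply/subset_leq_card/subsetP => _ /imsetP[s _ ->].
  by rewrite !inE /= big_map big_enum /=.
move=> /injectivePn[s [s' neq_s [eq_code eq_sum]]]; exists s, s'; split=> // i.
by move/eq_in_map/(_ i (mem_enum _ i)): eq_sum => /(congr1 val).
Qed.

End Permutations.

(** * Substitution of polynomials of degree at most 1 into a decision tree *)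

Section Substitution.
Variables (R : realType) (n k : nat).
Implicit Types (L : 'I_n -> mpoly k R).

Lemma msizeM_leq (p q : mpoly k R) a b :
  (msize p <= a.+1)%N -> (msize q <= b.+1)%N -> (msize (p * q) <= (a + b).+1)%N.
Proof.
have [->|p_neq0] := eqVneq p 0; first by rewrite mul0r mmeasure0.
have [->|q_neq0] := eqVneq q 0; first by rewrite mulr0 mmeasure0.
rewrite msizeM //; move: (msize p) (msize q) => x y; lia.
Qed.

Definition subst_mpoly L (p : mpoly n R) : mpoly k R :=
  comp_mpoly [tuple L i | i < n] p.

Lemma meval_subst L p (z : 'I_k -> R) :
  meval z (subst_mpoly L p) = meval (fun i => meval z (L i)) p.
Proof.
rewrite comp_mpoly_meval; apply: meval_eq => i.
by rewrite tnth_mktuple.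
Qed.

(** Substituted polynomials of degree at most 1 do not raise the total degree, so the reduction
    preserves the degree bound of the tree. *)
Lemma msize_subst L p d : (forall i, (msize (L i) <= 2)%N) ->
  (msize p <= d.+1)%N -> (msize (subst_mpoly L p) <= d.+1)%N.
Proof.
move=> le_L le_p; rewrite /subst_mpoly comp_mpolyEX.
apply: leq_trans (mmeasure_sum _ _ _ _) _; rewrite big_seq.
elim/big_ind: _ => [//|a b le_a le_b|m mp]; first by rewrite geq_max le_a.
have le_m : (mdeg m <= d)%N by rewrite -ltnS (leq_trans (msize_mdeg_lt mp)).
apply: leq_trans (mmeasureZ_le _ _ _) _; rewrite comp_mpolyX.
suff : (msize (\prod_(i < n) tnth [tuple L i | i < n] i ^+ m i)
          <= (\sum_(i < n) m i).+1)%N.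
  by move/leq_trans; apply; rewrite -mdegE.
elim/big_rec2: _ => [|i e q _ le_q]; first by rewrite mmeasure1.
apply: msizeM_leq => //; rewrite tnth_mktuple.
elim: (m i) => [|j IH]; first by rewrite expr0 mmeasure1.
by rewrite exprS; apply: (@msizeM_leq _ _ 1).
Qed.

Fixpoint subst_adt (A : Type) L (t : adt R n A) : adt R k A :=
  match t with
  | Leaf a => Leaf _ _ a
  | Node p t1 t2 t3 =>
      Node (subst_mpoly L p) (subst_adt L t1) (subst_adt L t2) (subst_adt L t3)
  end.

Lemma run_subst (A : Type) L (t : adt R n A) z :
  run (subst_adt L t) z = run t (fun i => meval z (L i)).
Proof. by elim: t => //= p t1 -> t2 -> t3 ->; rewrite meval_subst. Qed.

Lemma depth_subst (A : Type) L (t : adt R n A) : depth (subst_adt L t) = depth t.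
Proof. by elim: t => //= p t1 -> t2 -> t3 ->. Qed.

Lemma degree_subst (A : Type) L (t : adt R n A) d :
  (forall i, (msize (L i) <= 2)%N) ->
  degree_le d t -> degree_le d (subst_adt L t).
Proof.
move=> le_L; elim: t => //= p t1 IH1 t2 IH2 t3 IH3 [le_p /IH1 ? /IH2 ? /IH3 ?].
by split=> //; apply: msize_subst.
Qed.

End Substitution.

(** * Terrains with unit horizontal steps *)

Section UnitTerrain.
Variables (R : realType) (n : nat) (s : nat -> R).
Implicit Types (i j v : 'I_n) (w : R * R).

(** With unit steps, the rise [s e] of the edge from vertex [e] to vertex [e.+1] is also its
    slope. *)
Definition height (j : nat) : R := \sum_(e < j) s e.

Lemma heightS (j : nat) : height j.+1 = height j + s j.
Proof. by rewrite /height big_ord_recr. Qed.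

Lemma unit_terrain_mono i j : (i < j)%N ->
  ((i : nat)%:R, height i).1 < ((j : nat)%:R, height j).1 :> R.
Proof. by rewrite ltr_nat. Qed.

Definition unit_terrain : terrain R n := Terrain unit_terrain_mono.

Lemma nbhs_pairP (a : R * R) (P : R * R -> Prop) :
  (\forall p \near nbhs a, P p) <->
  exists2 e : R, 0 < e & forall p, `|a.1 - p.1| < e -> `|a.2 - p.2| < e -> P p.
Proof.
rewrite -nbhs_ballE; split.
  case=> e /= e_gt0 sub_P; exists e => // p p1 p2; apply: sub_P.
  by split; rewrite -ball_normE.
case=> e e_gt0 sub_P; exists e => //= p [] /=; rewrite -!ball_normE /=.
exact: sub_P.
Qed.

(** An edge of slope [s e] is the vector [(1, s e)], so traversing it from left to right changes the
    product with [w] by [w.1 + s e * w.2]. *)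
Lemma local_max_unit w v : internal v ->
  local_max unit_terrain w v =
    (0 < w.1 + s v.-1 * w.2) && (w.1 + s v * w.2 < 0).
Proof.
move=> /andP[v_gt0 v_lt].
have lt_u : (v.-1 < n)%N by lia.
have lt_w : (v.+1 < n)%N by lia.
have Ev : (v : nat) = v.-1.+1 by lia.
have dotE j : dot (unit_terrain j) w = j%:R * w.1 + height j * w.2 by [].
apply/forallP/andP => [max_v|[gt0 lt0] j].
  split.
    have nb_u : neighbors v (Ordinal lt_u) by rewrite /neighbors /= -Ev eqxx orbT.
    have := implyP (max_v (Ordinal lt_u)) nb_u; rewrite !dotE /=.
    rewrite [X in _ < X%:R * _ + height X * _]Ev.
    by rewrite heightS -natr1 /=; nra.
  have nb_w : neighbors v (Ordinal lt_w) by rewrite /neighbors /= eqxx.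
  have := implyP (max_v (Ordinal lt_w)) nb_w; rewrite !dotE /=.
  by rewrite heightS -natr1 /=; nra.
apply/implyP => /orP[] /eqP Ej; rewrite !dotE.
  by rewrite Ej heightS -natr1; nra.
have Ej' : v.-1 = j by rewrite Ej.
by rewrite Ej' in gt0; rewrite Ej heightS -natr1; nra.
Qed.

Lemma on_unit_terrainP (p : R * R) :
  on_terrain unit_terrain p <->
  exists2 j : nat, (j.+1 < n)%N & exists2 r : R, 0 <= r <= 1 &
    p = (j%:R + r, height j + r * s j).
Proof.
split.
  move=> [i [j [/orP[] /eqP Ej [r /andP[r_ge0 r_le1] ->]]]].
    exists i; first by rewrite -Ej.
    exists r; first by rewrite r_ge0.
    by rewrite /= Ej heightS -natr1; congr (_, _); ring.
  exists j; first by rewrite -Ej.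
  exists (1 - r); first by lra.
  by rewrite /= Ej heightS -natr1; congr (_, _); ring.
case=> j lt_j [r r01 ->]; exists (Ordinal (ltnW lt_j)), (Ordinal lt_j).
split; first by rewrite /neighbors eqxx.
exists r => //=; rewrite heightS -natr1; congr (_, _); ring.
Qed.

(** Points close to [v] on its two edges force the slope of the line strictly between those of the
    edges; conversely the mean of the two slopes works. *)
Lemma convex_unit v : internal v -> convex unit_terrain v <-> s v < s v.-1.
Proof.
move=> /andP[v_gt0 v_lt]; have Ev : (v : nat) = v.-1.+1 by lia.
have [u Eu] : exists u, u = v.-1 by exists v.-1.
rewrite -Eu in Ev *; split.
  case=> m /nbhs_pairP[e e_gt0 below].
  (* The bound 1 keeps the test points on the two edges at [v]; the other bound puts both
     coordinates within [e] of [v], with a factor 2 for strictness. *)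
  pose r := Num.min 1 (e / (1 + `|s u| + `|s v|) / 2).
  have C_gt0 : 0 < 1 + `|s u| + `|s v|.
    by have := normr_ge0 (s u); have := normr_ge0 (s v); lra.
  have r_gt0 : 0 < r by rewrite lt_min ltr01 !divr_gt0.
  have r_le1 : r <= 1 by rewrite ge_min lexx.
  have rC_lt : r * (1 + `|s u| + `|s v|) < e.
    have : r <= e / (1 + `|s u| + `|s v|) / 2 by rewrite ge_min lexx orbT.
    move=> le_r.
    apply: (@le_lt_trans _ _ (e / 2)); last by lra.
    by rewrite -ler_pdivlMr // mulrAC.
  have su_ge0 := normr_ge0 (s u); have sv_ge0 := normr_ge0 (s v).
  have r_lt : r < e by nra.
  have rsu_lt : `|r * s u| < e by rewrite normrM gtr0_norm //; nra.
  have rsv_lt : `|r * s v| < e by rewrite normrM gtr0_norm //; nra.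
  have right : s v < m.
    have on_p : on_terrain unit_terrain (v%:R + r, height v + r * s v).
      apply/on_unit_terrainP; exists v; first by lia.
      by exists r; rewrite ?(ltW r_gt0).
    have := below _ _ _ on_p; rewrite /=.
    have -> : v%:R - (v%:R + r) = - r :> R by ring.
    have -> : height v - (height v + r * s v) = - (r * s v) by ring.
    rewrite !normrN (gtr0_norm r_gt0) => /(_ r_lt rsv_lt) lt_m.
    suff : height v + r * s v < height v + m * (v%:R + r - v%:R) by nra.
    by apply: lt_m; case=> /eqP; rewrite -subr_eq0; lra.
  have left : m < s u.
    have on_p : on_terrain unit_terrain (v%:R - r, height v - r * s u).
      apply/on_unit_terrainP; exists u; first by lia.
      exists (1 - r); first by lra.
      by rewrite Ev heightS -natr1; congr (_, _); ring.
    have := below _ _ _ on_p; rewrite /=.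
    have -> : v%:R - (v%:R - r) = r :> R by ring.
    have -> : height v - (height v - r * s u) = r * s u by ring.
    rewrite (gtr0_norm r_gt0) => /(_ r_lt rsu_lt) lt_m.
    suff : height v - r * s u < height v + m * (v%:R - r - v%:R) by nra.
    by apply: lt_m; case=> /eqP; rewrite -subr_eq0; lra.
  exact: lt_trans left.
move=> lt_s; exists ((s u + s v) / 2); apply/nbhs_pairP.
(* Points on edges not incident to [v] are at horizontal distance at least 1, so this radius leaves
   only the edges [u] and [v]. *)
exists 1 => // p near1 _ /on_unit_terrainP[j lt_j [r /andP[r_ge0 r_le1] Ep]].
rewrite {p}Ep /= in near1 * => neq_p.
move: near1; rewrite ltr_norml => /andP[near_l near_r].
have [Ej|[Ej|[Ej|Ej]]] : (j < u \/ j = u \/ j = v \/ v < j)%N by lia.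
- have : (j.+1%:R : R) <= u%:R by rewrite ler_nat.
  by move: near_r; rewrite Ev -!natr1; lra.
- have r_lt1 : r < 1.
    rewrite lt_neqAle r_le1 andbT; apply/eqP => r1; apply: neq_p.
    by rewrite Ej Ev r1 heightS -natr1 mul1r.
  have : 0 < (1 - r) * (s u - s v) by rewrite mulr_gt0 ?subr_gt0.
  by rewrite Ej Ev heightS -(natr1 u); lra.
- have r_gt0 : 0 < r.
    rewrite lt_neqAle r_ge0 andbT; apply/eqP => r0; apply: neq_p.
    by rewrite Ej -r0 addr0 mul0r addr0.
  by rewrite Ej; nra.
- have : (v.+1%:R : R) <= j%:R by rewrite ler_nat.
  by move: near_l; rewrite -!natr1; lra.
Qed.

End UnitTerrain.

(** * The gadget terrain and its prickliness *)

Definition gadget (V : nzRingType) (k : nat) (z : 'I_k -> V) (e : nat) : V :=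
  if insub (e %/ 4)%N is Some i then nth 0 [:: z i + z i; z i; 1 + 1; 0] (e %% 4)
  else 0.

Lemma gadgetE (V : nzRingType) k (z : 'I_k -> V) (i : 'I_k) r : (r < 4)%N ->
  gadget z (4 * i + r) = nth 0 [:: z i + z i; z i; 1 + 1; 0] r.
Proof.
move=> r_lt; have Ei : ((4 * i + r) %/ 4 = i)%N by lia.
have Er : ((4 * i + r) %% 4 = r)%N by lia.
by rewrite /gadget Ei Er valK.
Qed.

Lemma gadget_mod3 (V : nzRingType) k (z : 'I_k -> V) e :
  (e %% 4 = 3)%N -> gadget z e = 0.
Proof. by rewrite /gadget => ->; case: insub. Qed.

Lemma gadget_out (V : nzRingType) k (z : 'I_k -> V) e :
  (k <= e %/ 4)%N -> gadget z e = 0.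
Proof. by move=> le_k; rewrite /gadget insubN // -leqNgt. Qed.

Section GadgetTerrain.
Variables (R : realType) (n k : nat).
Hypothesis lt_kn : (4 * k < n)%N.
Implicit Types (z : 'I_k -> R) (i : 'I_k) (v : 'I_n).

Lemma slot_subproof r i : (r < 4)%N -> (4 * i + r < n)%N.
Proof. by have := ltn_ord i; lia. Qed.

Definition slot r (lt_r : (r < 4)%N) i : 'I_n := Ordinal (slot_subproof i lt_r).

Let peak := @slot 1 isT.
Let spike := @slot 3 isT.

Lemma slot_inj r (lt_r : (r < 4)%N) : injective (slot lt_r).
Proof. by move=> i j /(congr1 val) /= E; apply: val_inj => /=; lia. Qed.

(** The last slot is vertex [4 * k - 1], and [lt_kn] leaves a vertex to its right. *)
Lemma slot_internal r (lt_r : (r < 4)%N) i : (0 < r)%N -> internal (slot lt_r i).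
Proof. by rewrite /internal /=; have := ltn_ord i; lia. Qed.

Lemma gadget_ge0 z e : (forall i, 0 < z i) -> 0 <= gadget z e.
Proof.
move=> z_gt0; rewrite /gadget; case: insubP => // i _ _.
have := z_gt0 i; have : (e %% 4 < 4)%N by lia.
by case: (e %% 4)%N => [|[|[|[|r]]]] //= _; lra.
Qed.

(** Elsewhere slopes do not drop: they pass from [z i] to 2, from 0 to a nonnegative slope at a
    block boundary, or remain 0 after the last block. *)
Lemma gadget_descent z v : (forall i, 0 < z i <= 1) -> (0 < v)%N ->
  gadget z v < gadget z v.-1 ->
  (exists i, v = spike i) \/ exists i, v = peak i.
Proof.
move=> z01 v_gt0; have z_gt0 i : 0 < z i by case/andP: (z01 i).
have [v0|v_neq0] := eqVneq (v %% 4)%N 0%N.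
  by rewrite (@gadget_mod3 _ _ _ v.-1) ?ltNge ?gadget_ge0 //; lia.
have [le_k|lt_k] := leqP k (v %/ 4).
  by rewrite (@gadget_out _ _ _ v.-1) ?ltNge ?gadget_ge0 //; lia.
pose i := Ordinal lt_k.
have : (v = 4 * i + 1 :> nat \/ v = 4 * i + 2 :> nat \/ v = 4 * i + 3 :> nat)%N.
  by rewrite /=; lia.
case=> [Ev|[Ev|Ev]].
- by move=> _; right; exists i; apply: val_inj.
- have -> : v.-1 = (4 * i + 1)%N by lia.
  rewrite Ev !gadgetE //=; have /andP[_] := z01 i; lra.
- by move=> _; left; exists i; apply: val_inj.
Qed.

Lemma gadget_peak z i : gadget z (peak i) = z i /\ gadget z (peak i).-1 = z i + z i.
Proof.
by split; [rewrite gadgetE | rewrite /= addn1 -(addn0 (4 * i)%N) gadgetE].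
Qed.

Lemma gadget_spike z i : gadget z (spike i) = 0 /\ gadget z (spike i).-1 = 1 + 1.
Proof.
split; first by rewrite gadgetE.
by rewrite /= addnS gadgetE.
Qed.

(** Only spikes and peaks are convex. Two peaks maximal in one direction would put [- w.1 / w.2] in
    two disjoint intervals, so at most one peak joins the [k] spikes. *)
Lemma prickliness_disjoint z : (forall i, 0 < z i <= 1) ->
    (forall i j, i != j -> z i + z i <= z j \/ z j + z j <= z i) ->
  (prickliness (unit_terrain n (gadget z)) <= k.+1)%N.
Proof.
move=> z01 disj; have [w <-] := prickliness_attained (unit_terrain n (gadget z)).
rewrite /prickliness_dir; set E := [set v | _].
pose I := [set i | peak i \in E].
have E_sub : E \subset (spike @: [set: 'I_k]) :|: (peak @: I).
  apply/fintype.subsetP => v vE; move: (vE).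
  rewrite inE => /and3P[v_int /asboolP v_cvx _].
  have v_gt0 : (0 < v)%N by case/andP: v_int.
  move/(convex_unit _ v_int): v_cvx => /(gadget_descent z01 v_gt0)[] [i Ei].
    by rewrite inE Ei imset_f ?inE.
  by rewrite inE Ei [X in _ || X]imset_f ?orbT // inE -Ei.
have card_I : (#|I| <= 1)%N.
  apply/card_le1_eqP => i j; rewrite !inE.
  move=> /and3P[int_i /asboolP/(convex_unit _ int_i) cvx_i].
  rewrite (local_max_unit _ _ int_i) => max_i.
  move=> /and3P[int_j _]; rewrite (local_max_unit _ _ int_j) => max_j.
  apply/eqP/negPn/negP => /disj; move: max_i max_j cvx_i.
  have [-> ->] := gadget_peak z i; have [-> ->] := gadget_peak z j.
  move=> /andP[i1 i2] /andP[j1 j2] zi_lt.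
  have /andP[zi _] := z01 i; have /andP[zj _] := z01 j.
  (* Subtracting the two inequalities at peak [i] gives [0 < z i * w.2]. *)
  have w2_gt0 : 0 < w.2 by nra.
  by case; nra.
apply: leq_trans (subset_leq_card E_sub) _.
apply: leq_trans (leq_card_setU _ _) _; rewrite -addn1 leq_add //.
  by rewrite (leq_trans (leq_imset_card _ _)) // cardsT card_ord.
by rewrite (leq_trans (leq_imset_card _ _)).
Qed.

Lemma prickliness_overlap z i j :
    (forall i, 0 < z i <= 1) -> i != j -> z i = z j ->
  (k.+2 <= prickliness (unit_terrain n (gadget z)))%N.
Proof.
(* The midpoint of the common interval of peaks [i] and [j]; it is at most 3/2, hence also inside
   the interval from 0 to 2 of every spike. *)
move=> z01 neq_ij Ez; pose m := z i + z i / 2.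
apply: leq_trans (prickliness_dir_le _ (- m, 1)); rewrite /prickliness_dir.
set E := [set v | _].
have in_E v : internal v -> gadget z v < m < gadget z v.-1 -> v \in E.
  move=> v_int /andP[lt_m gt_m]; rewrite inE v_int (local_max_unit _ _ v_int) /=.
  apply/andP; split; last by apply/andP; split; lra.
  by apply/asboolP/(convex_unit _ v_int); apply: lt_trans lt_m gt_m.
have /andP[zi_gt0 zi_le1] := z01 i.
have sub_E : (spike @: [set: 'I_k]) :|: [set peak i; peak j] \subset E.
  apply/fintype.subsetP => v /finset.setUP[/imsetP[l _ ->]|/finset.set2P[] ->].
  - apply: in_E; first exact: slot_internal.
    by have [-> ->] := gadget_spike z l; rewrite /m; lra.
  - apply: in_E; first exact: slot_internal.
    by have [-> ->] := gadget_peak z i; rewrite /m; lra.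
  - apply: in_E; first exact: slot_internal.
    by have [-> ->] := gadget_peak z j; rewrite /m -Ez; lra.
apply: leq_trans (subset_leq_card sub_E).
rewrite cardsU disjoint_setI0 ?cards0 ?subn0.
  rewrite card_imset; last exact: slot_inj.
  by rewrite cardsT card_ord cards2 (inj_eq (@slot_inj _ _)) neq_ij addn2.
apply/pred0P => v /=; apply/negP => /andP[/imsetP[l _ ->]].
by rewrite !inE => /orP[] /eqP/(congr1 val) /=; lia.
Qed.

(** Instantiating [gadget] over the polynomial ring, at the variables, yields the terrain
    coordinates as polynomials in [z]; this is why [gadget] is stated for any ring. *)
Definition gadget_coord (c : 'I_(n + n)) : mpoly k R :=
  match split c with
  | inl i => (i : nat)%:R
  | inr i => \sum_(e < i) gadget (fun l => mpolyX R (mnm1 l)) e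
  end.

Lemma meval_gadget_coord z c :
  meval z (gadget_coord c) = coords (unit_terrain n (gadget z)) c.
Proof.
rewrite /gadget_coord /coords; case: split => v /=; first by rewrite rmorph_nat.
rewrite raddf_sum; apply: eq_bigr => e _ /=; rewrite /gadget.
case: insubP => [i _ _|_]; last by rewrite meval0.
have : (e %% 4 < 4)%N by lia.
case: (e %% 4)%N => [|[|[|[|r]]]] //= _;
  by rewrite ?mevalD ?mevalXU ?meval1 ?meval0.
Qed.

Lemma msize_gadget_coord c : (msize (gadget_coord c) <= 2)%N.
Proof.
have size_nat r : (msize (r%:R : mpoly k R) <= 2)%N.
  elim: r => [|r IH]; first by rewrite mmeasure0.
  by rewrite -natr1 (leq_trans (mmeasureD_le _ _ _)) // geq_max IH mmeasure1.
rewrite /gadget_coord; case: split => v; first exact: size_nat.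
apply: leq_trans (mmeasure_sum _ _ _ _) _.
elim/big_ind: _ => [//|a b le_a le_b|e _]; first by rewrite geq_max le_a.
rewrite /gadget; case: insubP => [i _ _|_]; last by rewrite mmeasure0.
have size_X : (msize (mpolyX R (mnm1 i)) <= 2)%N by rewrite msizeX mdeg1.
have : (e %% 4 < 4)%N by lia.
case: (e %% 4)%N => [|[|[|[|r]]]] //= _.
- by rewrite (leq_trans (mmeasureD_le _ _ _)) // geq_max size_X.
- exact: (size_nat 2%N).
- by rewrite mmeasure0.
Qed.

End GadgetTerrain.

(** * The depth bound *)

Lemma degree_leS (R : realType) N (A : Type) d (t : adt R N A) :
  degree_le d t -> degree_le d.+1 t.
Proof. by elim: t => //= p t1 IH1 t2 IH2 t3 IH3 [/leqW ? /IH1 ? /IH2 ? /IH3 ?]. Qed.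

(** Otherwise two permutations collide, and the tree answers alike at [x ^+ w l], where the
    prickliness is at most [k.+1], and at [x ^+ u l], where it is at least [k.+2]. *)
Lemma fact_le_leaves (R : realType) d n k (t : adt R (n + n) nat) :
    (4 * k < n)%N -> (0 < d)%N -> degree_le d t -> computes_prickliness t ->
  (k`! <= 3 ^ depth t * 2 ^ (k + d * depth t))%N.
Proof.
move=> lt_kn d_gt0 le_d t_ok; rewrite leqNgt; apply/negP => lt_fact.
pose L := @gadget_coord R n k; pose t' := subst_adt L t.
have le_d' : degree_le d t' by apply: degree_subst le_d; apply: msize_gadget_coord.
have run_t' z : run t' z = prickliness (unit_terrain n (gadget z)).
  rewrite run_subst -t_ok; congr run; apply/funext => c.
  exact: meval_gadget_coord.
rewrite -(depth_subst L t) -/t' in lt_fact.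
have [s [s' [neq_s eq_code eq_sum]]] := path_collision le_d' lt_fact.
have [i [j [a [b [neq_ij a_gt0 eq_ij]]]]] := perm_weight_balance d_gt0 neq_s.
set w := perm_weight d s in eq_code eq_sum eq_ij.
set w' := perm_weight d s' in eq_code eq_sum eq_ij.
pose u l := (a * w l + b * w' l)%N.
have [e e_gt0 run_eq] := run_comb (perm_weight_generic (s := s))
  (perm_weight_generic (s := s')) a_gt0 (fun l => erefl (u l)) le_d' eq_code eq_sum.
(* Below [e] the two runs agree; at most 1/2, distinct exponents give powers a factor 2 apart, hence
   disjoint intervals. *)
pose x := Num.min (e / 2) (1 / 2).
have x_gt0 : 0 < x by rewrite lt_min !divr_gt0.
have x_lt_e : x < e.
  by apply: (@le_lt_trans _ _ (e / 2)); [rewrite ge_min lexx | lra].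
have x_le : x <= 1 / 2 by rewrite ge_min lexx orbT.
have pow01 r : 0 < x ^+ r <= 1 by rewrite exprn_gt0 // exprn_ile1 //; lra.
have := run_eq x; rewrite x_gt0 x_lt_e => /(_ isT); rewrite !run_t' => E.
have := prickliness_overlap lt_kn (z := fun l => x ^+ u l) (fun l => pow01 (u l))
  neq_ij (congr1 _ eq_ij).
rewrite -E leqNgt ltnS prickliness_disjoint // => l l' neq_l.
have double p q : (p < q)%N -> x ^+ q + x ^+ q <= x ^+ p.
  move=> lt_pq; have le_q : x ^+ q <= x ^+ p.+1.
    by rewrite ler_wiXn2l ?(ltW x_gt0) //; lra.
  have /andP[p_gt0 _] := pow01 p; rewrite exprS in le_q; nra.
have : w l != w l'.
  rewrite /w /perm_weight eqn_exp2l // val_eqE (inj_eq perm_inj); exact: neq_l.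
by rewrite neq_ltn => /orP[] /double; auto.
Qed.

Lemma expnn_le_depth (R : realType) (d n k : nat) (t : adt R (n + n) nat) :
    (4 * k < n)%N -> degree_le d t -> computes_prickliness t ->
  (k ^ k <= 2 ^ (2 * ((d + 3) * depth t + k)))%N.
Proof.
move=> lt_kn le_d t_ok.
(* Passing to [d.+1] covers [d = 0], where the permutation weights would all be 1. *)
have le_fact := fact_le_leaves lt_kn (ltn0Sn d) (degree_leS le_d) t_ok.
apply: leq_trans (expnn_le_fact_sqr k) _.
suff le2 : (k`! <= 2 ^ ((d + 3) * depth t + k))%N.
  by rewrite mulnC expnM -mulnn leq_mul.
apply: leq_trans le_fact _.
(* The summand [2 * depth t] absorbs the powers of 3, as 3 is at most [2 ^ 2]. *)
have -> : ((d + 3) * depth t + k = 2 * depth t + (k + d.+1 * depth t))%N by lia.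
rewrite (expnD 2 (2 * _)) expnM leq_mul2r.
case: (depth t) => [|h]; first by rewrite orbT.
by rewrite leq_exp2r // orbT.
Qed.

Theorem theorem7 (R : realType) (d : nat) :
  exists2 c : R, 0 < c &
  exists n0 : nat, forall n : nat, (n0 <= n)%N ->
  forall t : adt R (n + n) nat,
    degree_le d t -> computes_prickliness t ->
    c * (n%:R * ln n%:R) <= (depth t)%:R.
Proof.
(* With [k] at least [n / 8], the bound [C <= ln n] is what gives [ln n / 2 <= ln k - 2]. *)
pose C : R := 2 * ln 8 + 4.
(* The factor 32 is 8 from [n <= 8 * k], 2 from halving [ln n], and 2 from squaring the
   factorial. *)
exists (1 / (32 * (d + 3)%:R)); first by rewrite divr_gt0 // mulr_gt0 ?ltr0n ?addn3.
exists (maxn 8 (Num.truncn (expR C)).+1) => n.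
rewrite geq_max => /andP[n_ge8 n_big] t le_d t_ok.
(* The largest [k] with [4 * k < n]; from [n = 8] on it satisfies [n <= 8 * k]. *)
pose k := (n.-1 %/ 4)%N; set h := depth t.
have le_nk : (n <= 8 * k)%N by lia.
have k_gt0 : (0 < k)%N by lia.
have lt_kn : (4 * k < n)%N by lia.
have kR_gt0 : 0 < k%:R :> R by rewrite ltr0n.
have nR_gt0 : 0 < n%:R :> R by rewrite ltr0n; lia.
have ln_k : k%:R * ln k%:R <= 2 * ((d + 3)%:R * h%:R + k%:R) :> R.
  have := expnn_le_depth lt_kn le_d t_ok.
  rewrite -/h -(ler_nat R) !natrX => le_pow.
  have : ln (k%:R ^+ k) <= ln (2%:R ^+ (2 * ((d + 3) * h + k))) :> R.
    by rewrite ler_ln ?posrE ?exprn_gt0.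
  rewrite !lnXn //.
  rewrite -[ln k%:R *+ k]mulr_natl -[ln _ *+ (2 * _)]mulr_natl.
  rewrite natrM natrD natrM => /le_trans; apply.
  rewrite -[leRHS]mulr1 ler_wpM2l //.
    by have := ler0n R ((d + 3) * h + k); rewrite natrD natrM; lra.
  (* Here [ln 2 <= 1] comes from [ln (1 + x) <= x] at [x = 1]. *)
  by have := @le_ln1Dx R 1; rewrite -[1 + 1]/(2%:R); apply; lra.
have ln_nk : ln n%:R <= ln 8 + ln k%:R :> R.
  rewrite -lnM ?posrE // ler_ln ?posrE ?mulr_gt0 //.
  by rewrite -natrM ler_nat.
have ln_n : C <= ln n%:R.
  rewrite -[C]expRK ler_ln ?posrE ?expR_gt0 //; apply/ltW.
  by apply: lt_le_trans (truncnS_gt _) _; rewrite ler_nat.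
have nk : n%:R <= 8 * k%:R :> R by rewrite -natrM ler_nat.
have d_gt0 : 0 < (d + 3)%:R :> R by rewrite ltr0n addn3.
rewrite mul1r mulrC ler_pdivrMr ?mulr_gt0 //.
have ln8_ge0 : 0 <= ln 8 :> R by rewrite ln_ge0 // ler1n.
have : k%:R * (ln n%:R / 2) <= k%:R * (ln k%:R - 2) :> R.
  by rewrite ler_pM2l //; rewrite /C in ln_n; lra.
have : n%:R * ln n%:R <= 8 * k%:R * ln n%:R :> R.
  by rewrite ler_wpM2r //; rewrite /C in ln_n; lra.
lra.
Qed.
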